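(* Let $m,n \geq k \geq 1$ be integers, and let $A \in \mathbb{R}^{m \times n}$. The following statements are equivalent. (1) The matrix $A$ is totally non-negative of order $k$. (2) Every square submatrix of $A$ of size $r \leq k$ has the non-strict sign non-reversal property with respect to $\mathbb{R}^r$. (3) Every square submatrix of $A$ of size $r \leq k$ has the non-strict sign non-reversal property with respect to $\mathbb{R}^r_{\rm alt}$. (4) For every $r \in \{1,\dots,k\}$ and every $r \times r$ submatrix $B$ of $A$, the matrix $B$ has the non-strict sign non-reversal property with respect to the vector $z^B := \det(B)\, \mathrm{adj}(B)\, d^{\langle r \rangle} \in \mathbb{R}^r$ (that is, with respect to the one-element set $\{z^B\}$).
   Context: A real matrix is totally non-negative of order $k$ ($TN_k$) if all its minors of order (size) at most $k$ are non-negative. A submatrix is obtained by choosing a subset of the rows and a subset of the columns (not necessarily consecutive), kept in increasing order. For an integer $r \geq 1$: $d^{\langle r \rangle} := (1,-1,\dots,(-1)^{r-1})^T \in \mathbb{R}^r$. $\mathbb{R}^r_{\rm alt} \subset \mathbb{R}^r$ is the set of vectors all of whose components are nonzero and have alternating signs (consecutive components have opposite signs; for $r=1$, all nonzero reals). $\mathrm{adj}(B)$ is the adjugate matrix of the $r \times r$ matrix $B$ (for $r=1$, $\mathrm{adj}(B) = (1)$). Let $S \subseteq \mathbb{R}^r$. A matrix $B \in \mathbb{R}^{r \times r}$ has the non-strict sign non-reversal property with respect to $S$ if for every $0 \neq x \in S$ there is some $i \in \{1,\dots,r\}$ with $x_i \neq 0$ and $x_i (Bx)_i \geq 0$. (In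 particular, the property with respect to $\{0\}$ holds vacuously.) *)

(* Defs.v *)
From mathcomp Require Import all_boot all_order all_algebra.
From mathcomp Require Import all_classical all_reals.

Set Implicit Arguments.
Unset Strict Implicit.
Unset Printing Implicit Defensive.

Import Order.TTheory GRing.Theory Num.Theory.
Local Open Scope ring_scope.
Local Open Scope classical_set_scope.

Definition increasing (r m : nat) (f : 'I_r -> 'I_m) : Prop :=
  forall i j : 'I_r, (i < j)%N -> (f i < f j)%N.

(* A choice of rows (columns) kept in increasing order is the increasing map
   enumerating it, so the r x r submatrices of A are the mxsub f g A with f and
   g increasing.  They are the values B below; different (f, g) may give the
   same matrix B. *)
Definition square_submx (R : realType) (m n r : nat) (A : 'M[R]_(m, n))
    (B : 'M[R]_r) : Prop :=
  exists (f : 'I_r -> 'I_m) (g : 'I_r -> 'I_n),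
    [/\ increasing f, increasing g & B = mxsub f g A].

Definition TN (R : realType) (k m n : nat) (A : 'M[R]_(m, n)) : Prop :=
  forall (r : nat) (B : 'M[R]_r),
    (1 <= r <= k)%N -> square_submx A B -> 0 <= \det B.

Definition dalt (R : realType) (r : nat) : 'cV[R]_r := \col_i (-1) ^+ i.

Definition alt_vectors (R : realType) (r : nat) : set 'cV[R]_r :=
  [set x | (forall i : 'I_r, x i 0 != 0) /\
           (forall i j : 'I_r, j = i.+1 :> nat ->
              Num.sg (x j 0) = - Num.sg (x i 0))].

Definition sign_non_reversal (R : realType) (r : nat) (B : 'M[R]_r)
    (S : set 'cV[R]_r) : Prop :=
  forall x : 'cV[R]_r, S x -> x != 0 ->
    exists i : 'I_r, x i 0 != 0 /\ 0 <= x i 0 * (B *m x) i 0.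

Definition zvec (R : realType) (r : nat) (B : 'M[R]_r) : 'cV[R]_r :=
  \det B *: (\adj B *m dalt R r).

(* Main.v *)
(** If det B <> 0 and the maximal proper minors of B are non-negative, then
    z^B has alternating signs and B z^B = (det B)^2 d; a non-reversed
    coordinate of z^B therefore forces det B > 0. By induction on the size,
    (3) and (4) each give (1).

    For (1) => (2), suppose B is totally non-negative and all coordinates of
    x, y = B x satisfy x_i y_i < 0 (zero coordinates of x are first deleted
    with the same rows). Delete rows at which y repeats the previous sign: y
    becomes alternating of length p, and x is split into p consecutive blocks,
    the j-th of sign opposite to y_j. As long as there are more columns than
    rows, moving x along the kernel of B until a coordinate vanishes preserves
    y and the weak signs of x, so a column can be deleted. In the square
    case Cramer's rule shows that x alternates like y, whereas some remaining
    column still has the index of its block, a contradiction. *)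
Require Import Defs.
From mathcomp Require Import all_boot all_order all_algebra.
From mathcomp Require Import all_classical all_reals.
From mathcomp Require Import zify ring lra.

Set Implicit Arguments.
Unset Strict Implicit.
Unset Printing Implicit Defensive.

Import Order.TTheory GRing.Theory Num.Theory.
Local Open Scope ring_scope.
Local Open Scope classical_set_scope.

(** * Totally non-negative matrices and their submatrices *)

Definition totally_nonneg (R : realType) (m n : nat) (M : 'M[R]_(m, n)) :=
  forall (r : nat) (f : 'I_r -> 'I_m) (g : 'I_r -> 'I_n),
    increasing f -> increasing g -> 0 <= \det (mxsub f g M).

Lemma increasing_lift n (l : 'I_n) : increasing (lift l).
Proof. by move=> i j; rewrite /= /bump; lia. Qed.

Lemma increasing_comp m n p (f : 'I_n -> 'I_m) (g : 'I_p -> 'I_n) :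
  increasing f -> increasing g -> increasing (f \o g).
Proof. by move=> hf hg i j /hg /hf. Qed.

Lemma increasing_inj m n (f : 'I_n -> 'I_m) : increasing f -> injective f.
Proof.
move=> hf i j eq_f; apply: val_inj => /=.
by case: (ltngtP i j) => // /hf; rewrite eq_f ltnn.
Qed.

Lemma totally_nonneg_mxsub (R : realType) m n p q (M : 'M[R]_(m, n))
    (f : 'I_p -> 'I_m) (g : 'I_q -> 'I_n) :
  increasing f -> increasing g -> totally_nonneg M ->
  totally_nonneg (mxsub f g M).
Proof.
move=> hf hg hM r f' g' hf' hg'; rewrite -mxsub_comp.
by apply: hM; apply: increasing_comp.
Qed.

Lemma totally_nonneg_det (R : realType) n (M : 'M[R]_n) :
  totally_nonneg M -> 0 <= \det M.
Proof. by move=> /(_ n id id); rewrite mxsub_id; apply. Qed.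

Lemma totally_nonneg_minor (R : realType) n (M : 'M[R]_n) i j :
  totally_nonneg M -> 0 <= \det (row' i (col' j M)).
Proof.
move=> /(_ n.-1 (lift i) (lift j)) hM.
suff -> : row' i (col' j M) = mxsub (lift i) (lift j) M.
  by apply: hM; apply: increasing_lift.
by apply/matrixP => a b; rewrite !mxE.
Qed.

(** * Kernel vectors and column deletion *)

Lemma exists_col_kernel (F : fieldType) m n (M : 'M[F]_(m, n)) :
  ~~ row_free M^T -> exists2 v : 'cV[F]_n, v != 0 & M *m v = 0.
Proof.
rewrite -kermx_eq0 => /rowV0Pn [v /sub_kermxP vM v0].
exists v^T; first by rewrite trmx_eq0.
by apply: trmx_inj; rewrite trmx_mul trmxK vM trmx0.
Qed.

(** Among the ratios x_j / v_j with v_j nonzero, let c = x_l / v_l have least absolute value and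
    take t = -c. A coordinate x_j = d v_j becomes (d - c) v_j with |c| <= |d|, so it cannot cross
    zero. The factor [w] encodes either weak sign. *)
Lemma exists_shift_vanishing (R : realType) n (x v : 'cV[R]_n) :
  v != 0 -> exists (t : R) (l : 'I_n), (x + t *: v) l 0 = 0 /\
    forall j w, x j 0 * w <= 0 -> (x + t *: v) j 0 * w <= 0.
Proof.
move=> v0.
have /cV0Pn [i0 vi0] := v0.
case: (@Order.TotalTheory.arg_minP _ _ _ i0 (fun i => v i 0 != 0)
         (fun i => `|x i 0 / v i 0|) vi0) => l vl lmin.
exists (- (x l 0 / v l 0)), l; split=> [|j w hw].
  by rewrite !mxE mulNr divfK // subrr.
rewrite !mxE mulNr; set c := x l 0 / v l 0.
have [->|vj] := eqVneq (v j 0) 0; first by rewrite mulr0 subr0.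
have := lmin j vj; rewrite -/c.
set d := x j 0 / v j 0 => le_cd.
have xj : x j 0 = d * v j 0 by rewrite divfK.
rewrite xj in hw *; move: (v j 0) hw => a hw.
have -> : (d * a - c * a) * w = (d - c) * (a * w) by ring.
have {hw} : d * (a * w) <= 0 by rewrite mulrA.
move: (a * w) => e he.
move: le_cd; rewrite ler_norml.
case: (ger0P d) => hd /andP [] h1 h2; last first.
  have e0 : 0 <= e by rewrite -(nmulr_rle0 e hd).
  by apply: mulr_le0_ge0 => //; lra.
have [d0|d0] := eqVneq d 0; first by rewrite (_ : d - c = 0) ?mul0r //; lra.
have e0 : e <= 0 by rewrite -(pmulr_rle0 e (_ : 0 < d)) // lt0r d0.
by apply: mulr_ge0_le0 => //; lra.
Qed.

Lemma mulmx_mxsub_lift (R : realType) m n p (M : 'M[R]_(m, n.+1))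
    (x : 'cV[R]_n.+1) (f : 'I_p -> 'I_m) (l : 'I_n.+1) :
  x l 0 = 0 ->
  (mxsub f (lift l) M : 'M_(p, n)) *m row' l x = rowsub f (M *m x).
Proof.
move=> xl; apply/colP => i; rewrite !mxE (bigD1_ord l) //= xl mulr0 add0r.
by apply: eq_bigr => j _; rewrite !mxE.
Qed.

(** * Cramer's rule for alternating right-hand sides *)

Lemma adj_mulmxE (R : realType) n (M : 'M[R]_n) (y : 'cV[R]_n) (i : 'I_n) :
  (-1) ^+ i * (\adj M *m y) i 0 =
    \sum_j \det (row' j (col' i M)) * ((-1) ^+ j * y j 0).
Proof.
rewrite !mxE mulr_sumr; apply: eq_bigr => j _.
rewrite !mxE /cofactor exprD.
transitivity ((-1) ^+ i ^+ 2 * (\det (row' j (col' i M)) * ((-1) ^+ j * y j 0))).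
  by ring.
by rewrite sqrr_sign mul1r.
Qed.

(** If the sum vanished, so would every minor in it, and expanding along column [i] would give
    determinant zero. *)
Lemma minor_sum_gt0 (R : realType) n (M : 'M[R]_n) (a : 'I_n -> R) i :
  \det M != 0 -> (forall j, 0 <= \det (row' j (col' i M))) ->
  (forall j, 0 < a j) -> 0 < \sum_j \det (row' j (col' i M)) * a j.
Proof.
move=> dM minors a0.
have nneg j : true -> 0 <= \det (row' j (col' i M)) * a j.
  by move=> _; rewrite mulr_ge0 // ltW.
rewrite lt0r sumr_ge0 // andbT; apply: contra dM.
rewrite psumr_eq0 // => /allP h.
rewrite (expand_det_col M i) big1 // => j _.
have := h j; rewrite mem_index_enum => /(_ isT) /=.
rewrite mulf_eq0 (gt_eqF (a0 j)) orbF => /eqP d0.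
by rewrite /cofactor d0 !mulr0.
Qed.

(** In det(M) x = adj(M) M x the cofactor signs cancel the alternation of M x, which leaves a sum as
    in [minor_sum_gt0]. *)
Lemma alternating_preimage_nonsingular (R : realType) n (M : 'M[R]_n) (s : R)
    (x : 'cV[R]_n) :
  \det M != 0 -> totally_nonneg M ->
  (forall i : 'I_n, 0 < s * (-1) ^+ i * (M *m x) i 0) ->
  forall i : 'I_n, 0 < s * (-1) ^+ i * x i 0.
Proof.
move=> dM hM hy i.
have dM0 : 0 < \det M by rewrite lt0r dM totally_nonneg_det.
rewrite -(pmulr_rgt0 _ dM0).
have := @minor_sum_gt0 _ _ M (fun j => s * (-1) ^+ j * (M *m x) j 0) i dM
  (fun j => totally_nonneg_minor j i hM) hy.
under eq_bigr do rewrite -mulrA mulrCA.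
rewrite -mulr_sumr -adj_mulmxE mulmxA mul_adj_mx mul_scalar_mx mxE.
by congr (0 < _); ring.
Qed.

(* A singular M is impossible: killing a coordinate of x along the kernel and
   deleting that column together with the last row, resp. the first one, the
   induction hypothesis gives both signs to the first remaining entry of x. *)
Lemma alternating_preimage (R : realType) n (M : 'M[R]_n.+1) (s : R)
    (x : 'cV[R]_n.+1) :
  totally_nonneg M ->
  (forall i : 'I_n.+1, 0 < s * (-1) ^+ i * (M *m x) i 0) ->
  forall i : 'I_n.+1, 0 < s * (-1) ^+ i * x i 0.
Proof.
elim: n s M x => [|n IHn] s M x hM hy.
all: have [dM|] := eqVneq (\det M) 0; last by move=> dM; apply: alternating_preimage_nonsingular hy.
  have M00 : M 0 0 = 0 by rewrite -dM [RHS]det_mx11.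
  by have := hy 0; rewrite mxE big_ord1 M00 mul0r mulr0 ltxx.
have [v v0 Mv] : exists2 v : 'cV_n.+2, v != 0 & M *m v = 0.
  apply: exists_col_kernel.
  by rewrite row_free_unit unitmxE det_tr dM unitr0.
have [t [l [xl _]]] := exists_shift_vanishing x v0.
have yE : M *m (x + t *: v) = M *m x.
  by rewrite mulmxDr -scalemxAr Mv scaler0 addr0.
set x' := x + t *: v in xl yE.
have step (e : 'I_n.+2) s' :
    (forall i : 'I_n.+1, s' * (-1) ^+ i = s * (-1) ^+ (lift e i)) ->
    0 < s' * row' l x' 0 0.
  move=> hs.
  have := IHn s' (mxsub (lift e) (lift l) M) (row' l x') _ _ 0.
  rewrite expr0 mulr1; apply.
    by apply: totally_nonneg_mxsub => //; apply: (@increasing_lift n.+2).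
  by move=> i; rewrite mulmx_mxsub_lift // yE mxE hs.
have h1 : 0 < s * row' l x' 0 0 by apply: (step ord_max) => i; rewrite lift_max.
(* Without row 0 the remaining row indices drop by one, which turns [s] into [- s]. *)
have h2 : 0 < - s * row' l x' 0 0.
  by apply: (step ord0) => i; rewrite lift0 exprS; ring.
lra.
Qed.

(** * Blocks of columns of constant weak sign *)

Lemma monotone_ord_fixpoint n (b : 'I_n.+1 -> 'I_n.+1) :
  (forall i j : 'I_n.+1, (i <= j)%N -> (b i <= b j)%N) -> exists i, b i = i.
Proof.
move=> hb.
have h0 : (@ord0 n <= b ord0)%N by [].
(* The largest [i] with i <= b i is fixed: by monotonicity [b i] satisfies the same inequality, so b
   i <= i. *)
case: (@arg_maxnP _ ord0 (fun i : 'I_n.+1 => (i <= b i)%N) val h0) => i hi imax.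
exists i; apply: val_inj; apply/eqP; rewrite eqn_leq hi andbT.
by apply: imax; apply: hb.
Qed.

(* [b j] is the index of the block of columns containing j; blocks may be
   empty, so that columns can be deleted. *)
Lemma no_opposite_blocks_alternating (R : realType) p n (M : 'M[R]_(p.+1, n.+1)) (s : R)
    (x : 'cV[R]_n.+1) (b : 'I_n.+1 -> 'I_p.+1) :
  (p <= n)%N -> totally_nonneg M ->
  (forall i : 'I_p.+1, 0 < s * (-1) ^+ i * (M *m x) i 0) ->
  (forall i j : 'I_n.+1, (i <= j)%N -> (b i <= b j)%N) ->
  ~ (forall j, x j 0 * (s * (-1) ^+ b j) <= 0).
Proof.
elim: n M x b => [|n IHn] M x b le_pn hM hy hb hx;
  move: (le_pn); rewrite leq_eqVlt => /orP [/eqP eq_pn|lt_pn] //.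
(* Square case: at a fixed point of [b], the strict sign given by [alternating_preimage] contradicts
   [hx]. *)
all: try (subst p; have [i bi] := monotone_ord_fixpoint hb;
  have := alternating_preimage hM hy i; have := hx i; rewrite bi; lra).
have [v v0 Mv] : exists2 v : 'cV_n.+2, v != 0 & M *m v = 0.
  apply: exists_col_kernel.
  by rewrite /row_free mxrank_tr neq_ltn (leq_ltn_trans (rank_leq_row M)).
have [t [l [xl hxt]]] := exists_shift_vanishing x v0.
have yE : M *m (x + t *: v) = M *m x.
  by rewrite mulmxDr -scalemxAr Mv scaler0 addr0.
apply: (IHn (mxsub id (lift l) M) (row' l (x + t *: v)) (b \o lift l)) => //.
- by apply: totally_nonneg_mxsub => //; apply: (@increasing_lift n.+2).
- by move=> i; rewrite mulmx_mxsub_lift // yE mxE.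
- by move=> i j le_ij; apply: hb; rewrite /= leq_bump2.
- by move=> j; rewrite mxE; apply: hxt.
Qed.

Lemma no_opposite_blocks (R : realType) m n (M : 'M[R]_(m.+1, n.+1))
    (x : 'cV[R]_n.+1) (b : 'I_n.+1 -> 'I_m.+1) :
  (m <= n)%N -> totally_nonneg M ->
  (forall i, (M *m x) i 0 != 0) ->
  (forall i j : 'I_n.+1, (i <= j)%N -> (b i <= b j)%N) ->
  ~ (forall j, x j 0 * (M *m x) (b j) 0 <= 0).
Proof.
elim: m M b => [|m IHm] M b le_mn hM hy hb hx.
  apply: (no_opposite_blocks_alternating (s := (M *m x) 0 0) (x := x) le_mn hM _ hb).
    by move=> i; rewrite ord1 expr0 mulr1 -expr2 exprn_even_gt0 //= hy.
  by move=> j; have := hx j; rewrite ord1 expr0 mulr1.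
have [[i hi]|halt] := pselect (exists i : 'I_m.+1,
    0 < (M *m x) (lift ord_max i) 0 * (M *m x) (lift ord0 i) 0).
  (* Row i + 1 is deleted and its block is merged into block i. *)
  have hc j : ((if (b j <= i)%N then b j : nat else (b j).-1) < m.+1)%N.
    by have := ltn_ord (b j); have := ltn_ord i; case: ifP; lia.
  pose c j := Ordinal (hc j).
  apply: (IHm (mxsub (lift (lift ord0 i)) id M) c).
  - exact: ltnW.
  - by apply: totally_nonneg_mxsub => //; apply: (@increasing_lift m.+2).
  - by move=> k; rewrite mul_rowsub_mx mxE.
  - by move=> j k le_jk; have /= := hb _ _ le_jk; do 2 case: ifP; lia.
  - move=> j; rewrite mul_rowsub_mx mxE.
    have := hx j.
    (* A column of block i + 1 is now compared with row i; by [hi] both entries of M x have the same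
       sign, so its inequality survives. *)
    case: (eqVneq (b j : nat) i.+1) => [bj|bj]; last first.
      suff -> : lift (lift ord0 i) (c j) = b j by [].
      by apply: val_inj; rewrite /= /bump /=; case: ifP; lia.
    have -> : lift (lift ord0 i) (c j) = lift ord_max i.
      by apply: val_inj; have := ltn_ord i; rewrite /= /bump bj; case: ifP; lia.
    have -> : b j = lift ord0 i by apply: val_inj; rewrite /= /bump bj.
    move: hi; move: ((M *m x) (lift ord_max i) 0) ((M *m x) (lift ord0 i) 0).
    move: (x j 0) => z u w.
    case: (ltrgt0P u) => [u0|u0|->]; last by rewrite mul0r ltxx.
    + by rewrite pmulr_rgt0 // => w0; rewrite !pmulr_lle0.
    + by rewrite nmulr_rgt0 // => w0; rewrite !nmulr_lle0.
(* No two consecutive entries of M x share a sign, so M x alternates, and its entry 0 can serve as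
   [s]. *)
have hs (i : nat) (lt_im : (i < m.+2)%N) :
    0 < (M *m x) 0 0 * (-1) ^+ i * (M *m x) (Ordinal lt_im) 0.
  elim: i lt_im => [|i IHi] lt_im.
    rewrite expr0 mulr1 (_ : Ordinal _ = 0); last exact: val_inj.
    by rewrite -expr2 exprn_even_gt0 //= hy.
  have := IHi (ltnW lt_im).
  have lt_i : (i < m.+1)%N by [].
  have : ~ 0 < (M *m x) (Ordinal (ltnW lt_im)) 0 * (M *m x) (Ordinal lt_im) 0.
    move=> h; apply: halt; exists (Ordinal lt_i).
    rewrite (_ : lift ord_max _ = Ordinal (ltnW lt_im)); last first.
      by apply: val_inj; rewrite /= /bump; lia.
    by rewrite (_ : lift ord0 _ = Ordinal lt_im) //; apply: val_inj.
  have := hy (Ordinal lt_im).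
  rewrite exprS mulN1r mulrN mulNr.
  move: ((M *m x) (Ordinal _) 0) => u; move: ((M *m x) (Ordinal _) 0) => w.
  move: (_ * (-1) ^+ i) => a u0 /negP; rewrite -leNgt => wu.
  case: (ltrgt0P w) => [w0|w0|->]; last by rewrite mulr0 ltxx.
    rewrite pmulr_lgt0 // => a0; rewrite oppr_gt0 pmulr_rlt0 //.
    by rewrite lt_neqAle u0 -(pmulr_rle0 _ w0).
  rewrite nmulr_lgt0 // => a0; rewrite oppr_gt0 nmulr_rlt0 //.
  by rewrite lt0r u0 -(nmulr_rle0 _ w0).
have hs' (i : 'I_m.+2) : 0 < (M *m x) 0 0 * (-1) ^+ i * (M *m x) i 0.
  by case: i => i lt_im; apply: hs.
apply: (no_opposite_blocks_alternating le_mn hM hs' hb) => j.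
move: (hs' (b j)) (hx j); move: ((M *m x) (b j) 0) (x j 0) => u w.
move: (_ * _ ^+ _) => a.
case: (ltrgt0P u) => [u0|u0|->]; last by rewrite mulr0 ltxx.
  by rewrite pmulr_lgt0 // pmulr_lle0 // => a0 w0; rewrite pmulr_lle0.
by rewrite nmulr_lgt0 // nmulr_lle0 // => a0 w0; rewrite nmulr_lle0.
Qed.

Lemma totally_nonneg_sign_non_reversal (R : realType) n (M : 'M[R]_n) :
  totally_nonneg M -> sign_non_reversal M setT.
Proof.
elim: n M => [|n IHn] M hM x _ x0; first by case/cV0Pn: x0 => -[].
have [[l xl]|xN0] := pselect (exists l, x l 0 = 0).
  have x'0 : row' l x != 0.
    case/cV0Pn: x0 => i xi; apply/cV0Pn.
    have : l != i by apply: contraNneq xi => <-; rewrite xl.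
    by case/unlift_some => j ij _; exists j; rewrite mxE -ij.
  have hM' : totally_nonneg (mxsub (lift l) (lift l) M).
    by apply: totally_nonneg_mxsub => //; apply: (@increasing_lift n.+1).
  have [i [xi yi]] := IHn _ hM' _ I x'0.
  by exists (lift l i); move: xi yi; rewrite mulmx_mxsub_lift // !mxE.
apply: contrapT => hN.
have hlt i : x i 0 * (M *m x) i 0 < 0.
  rewrite ltNge; apply/negP => h; apply: hN; exists i; split=> //.
  by apply/eqP => xi; apply: xN0; exists i.
(* Initially every column is a block of its own. *)
apply: (@no_opposite_blocks _ _ _ M x id) => //.
  by move=> i; apply: contraTneq (hlt i) => ->; rewrite mulr0 ltxx.
by move=> j; rewrite ltW.
Qed.

(** * Minors of bounded order *)

Lemma TN_submx_totally_nonneg (R : realType) k m n (A : 'M[R]_(m, n)) r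
    (B : 'M[R]_r) :
  TN k A -> (r <= k)%N -> square_submx A B -> totally_nonneg B.
Proof.
move=> hA le_rk [f [g [hf hg ->]]] [|q] f' g' hf' hg'; first by rewrite det_mx00.
rewrite -mxsub_comp; apply: hA; last first.
  by exists (f \o f'), (g \o g'); split=> //; apply: increasing_comp.
(* Injectivity of [f'] bounds the order of the minor by [r], hence by [k]. *)
have := leq_card _ (increasing_inj hf'); rewrite !card_ord /=.
by move/leq_trans; apply.
Qed.

(** Induction on the size: deleting a row and a column of [B] leaves a smaller submatrix of [A],
    already treated, or the empty matrix, of determinant 1. *)
Lemma TN_minor_ind (R : realType) k m n (A : 'M[R]_(m, n)) :
  (forall r (B : 'M[R]_r), (1 <= r <= k)%N -> square_submx A B ->
     (forall i j, 0 <= \det (row' i (col' j B))) -> 0 <= \det B) ->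
  TN k A.
Proof.
move=> step; elim=> [//|r IHr] B le_rk subB; apply: step => // i j.
case: r => [|r] in IHr B le_rk subB i j *; first by rewrite det_mx00.
case: subB => f [g [hf hg ->]].
apply: IHr; first by case/andP: le_rk => _ /ltnW.
exists (f \o lift i), (g \o lift j); split.
- exact: increasing_comp hf (@increasing_lift r.+2 i).
- exact: increasing_comp hg (@increasing_lift r.+2 j).
- by apply/matrixP => a b; rewrite !mxE.
Qed.

(** * Signs of the vector z^B *)

Lemma zvecE (R : realType) r (B : 'M[R]_r) (i : 'I_r) :
  (-1) ^+ i * zvec B i 0 = \det B * \sum_j \det (row' j (col' i B)).
Proof.
rewrite /zvec mxE mulrCA adj_mulmxE; congr (_ * _).
by apply: eq_bigr => j _; rewrite mxE -expr2 sqrr_sign mulr1.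
Qed.

(** The cofactor signs cancel those of d, so the quantity is det(B)^2 times a sum of non-negative
    minors, not all zero. *)
Lemma zvec_sign (R : realType) r (B : 'M[R]_r) (i : 'I_r) :
  (forall i j, 0 <= \det (row' i (col' j B))) -> \det B != 0 ->
  0 < \det B * ((-1) ^+ i * zvec B i 0).
Proof.
move=> minors dB; rewrite zvecE mulrA -expr2 mulr_gt0 ?exprn_even_gt0 //.
have := @minor_sum_gt0 _ _ B (fun=> 1) i dB (fun j => minors j i).
by under eq_bigr do rewrite mulr1; apply.
Qed.

Lemma mulmx_zvec (R : realType) r (B : 'M[R]_r) :
  B *m zvec B = (\det B) ^+ 2 *: dalt R r.
Proof.
by rewrite /zvec -scalemxAr mulmxA mul_mx_adj mul_scalar_mx scalerA.
Qed.

Lemma zvec_alt (R : realType) r (B : 'M[R]_r) :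
  (forall i j, 0 <= \det (row' i (col' j B))) -> \det B != 0 ->
  alt_vectors (zvec B).
Proof.
move=> minors dB; have hz i := zvec_sign i minors dB.
have sgz i : Num.sg (zvec B i 0) = (-1) ^+ i * Num.sg (\det B).
  have /gtr0_sg := hz i; rewrite !sgrM sgrX sgrN1.
  have d2 : Num.sg (\det B) ^+ 2 = 1 by rewrite sqr_sg dB.
  have e2 : ((-1) ^+ i : R) ^+ 2 = 1 := sqrr_sign _ i.
  move: (Num.sg (\det B)) (Num.sg (zvec B i 0)) ((-1) ^+ i) d2 e2.
  move=> d z e d2 e2 dez.
  transitivity (d ^+ 2 * e ^+ 2 * z); first by rewrite d2 e2 !mul1r.
  by rewrite -[RHS]mulr1 -dez; ring.
split=> [i|i j ij]; last by rewrite !sgz ij exprS mulN1r mulNr.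
by apply: contraTneq (hz i) => ->; rewrite !mulr0 ltxx.
Qed.

Lemma sign_non_reversal_zvec_det (R : realType) r (B : 'M[R]_r) :
  (0 < r)%N -> (forall i j, 0 <= \det (row' i (col' j B))) ->
  sign_non_reversal B [set zvec B] -> 0 <= \det B.
Proof.
move=> r0 minors hB; have [->//|dB] := eqVneq (\det B) 0.
have z0 : zvec B != 0.
  by apply/cV0Pn; exists (Ordinal r0); apply: (zvec_alt minors dB).1.
have [i [zi]] := hB _ erefl z0.
rewrite mulmx_zvec [X in _ * X]mxE [dalt R r i 0]mxE mulrCA.
rewrite pmulr_rge0 ?exprn_even_gt0 // mulrC => w0.
have w_gt0 : 0 < (-1) ^+ i * zvec B i 0.
  by rewrite lt0r w0 mulf_neq0 // signr_eq0.
by rewrite ltW // -(pmulr_lgt0 _ w_gt0) zvec_sign.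
Qed.

Lemma sign_non_reversal_alt_zvec (R : realType) r (B : 'M[R]_r) :
  (forall i j, 0 <= \det (row' i (col' j B))) ->
  sign_non_reversal B (@alt_vectors R r) -> sign_non_reversal B [set zvec B].
Proof.
move=> minors hB x -> z0; apply: hB (z0); apply: zvec_alt => //.
(* A zero determinant would make z^B zero, where the property is vacuous. *)
by apply: contraNneq z0 => d0; rewrite /zvec d0 scale0r.
Qed.

Theorem theoremC (R : realType) (m n k : nat)
    (hk : (1 <= k)%N) (hm : (k <= m)%N) (hn : (k <= n)%N)
    (A : 'M[R]_(m, n)) :
  [<-> TN k A ;
       forall (r : nat) (B : 'M[R]_r), (1 <= r <= k)%N ->
         square_submx A B -> sign_non_reversal B setT ;
       forall (r : nat) (B : 'M[R]_r), (1 <= r <= k)%N ->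
         square_submx A B -> sign_non_reversal B (@alt_vectors R r) ;
       forall (r : nat) (B : 'M[R]_r), (1 <= r <= k)%N ->
         square_submx A B -> sign_non_reversal B [set zvec B] ].
Proof.
have TN_snr : TN k A -> forall (r : nat) (B : 'M[R]_r), (1 <= r <= k)%N ->
    square_submx A B -> sign_non_reversal B setT.
  move=> hA r B /andP [_ le_rk] subB.
  exact/totally_nonneg_sign_non_reversal/(TN_submx_totally_nonneg hA).
tfae=> //.
- by move=> hA r B hr subB x _; apply: (hA r B).
(* From (3), induction on the size yields (1), hence (2), of which (4) is a special case. *)
- move=> hA r B hr subB x _; apply: (TN_snr _ r B) => //.
  apply: TN_minor_ind => q C hq subC minors.
  apply: sign_non_reversal_zvec_det => //; first by case/andP: hq.
  by apply: sign_non_reversal_alt_zvec => //; apply: hA.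
- move=> hA; apply: TN_minor_ind => r B hr subB minors.
  apply: sign_non_reversal_zvec_det => //; first by case/andP: hr.
  exact: hA.
Qed.
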